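(* Let $A=(a_{ij})$ be an $n\times n$ complex irreducible matrix. For each $i\in\{1,2,\ldots,n\}$ let $l_i$ be the number of nonzero off-diagonal entries in the $i$th row of $A$, i.e. $l_i=|\{j\in\{1,\ldots,n\}\setminus\{i\} : a_{ij}\neq 0\}|$. Then $$\rho(A)\leq \max_{1\leq i\leq n}\Bigg\{|a_{ii}|+\sqrt{\sum_{k=1,\,k\neq i}^{n} l_k |a_{ki}|^2}\Bigg\}.$$ If equality holds, then $$|a_{ii}|+\sqrt{\sum_{k=1,\,k\neq i}^{n} l_k |a_{ki}|^2}=|a_{jj}|+\sqrt{\sum_{k=1,\,k\neq j}^{n} l_k |a_{kj}|^2}$$ for any $i,j\in\{1,2,\ldots,n\}$.
   Context: The spectral radius $\rho(M)$ of a square matrix $M$ is the largest modulus of its (complex) eigenvalues. *)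

(* Defs.v *)
From mathcomp Require Import all_boot all_order all_fingroup all_algebra.
From mathcomp Require Import boolp classical_sets reals.
From mathcomp Require Export complex.
Set Implicit Arguments.
Unset Strict Implicit.
Unset Printing Implicit Defensive.
Import Order.TTheory GRing.Theory Num.Theory.
Local Open Scope classical_set_scope.
Local Open Scope ring_scope.

(* The norm `|z| of z : R[i] is again an element of R[i]; its real-valued
   version is Normc.normc z : R. *)
Notation cmod := Normc.normc (only parsing).

(* mathcomp's eigenvalue uses left (row) eigenvectors; by
   eigenvalue_root_char the eigenvalues are the roots of char_poly A. The
   supremum is attained when n > 0: see spectral_radius_max. *)
Definition spectral_radius (R : realType) (n : nat) (A : 'M[R[i]]_n) : R :=
  sup [set cmod z | z in [set z : R[i] | eigenvalue A z]].

(* For some permutation matrix P, P A P^T = [B C; 0 D] with square diagonal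
   blocks B of size r and D of size n - r, both nonempty. In particular no
   1 x 1 matrix, zero or not, is reducible. *)
Definition reducible_matrix (F : fieldType) (n : nat) (A : 'M[F]_n) : Prop :=
  exists (s : 'S_n) (r : nat), (0 < r < n)%N /\
    forall i j : 'I_n, (r <= i)%N -> (j < r)%N ->
      (perm_mx s *m A *m (perm_mx s)^T) i j = 0.

Definition irreducible_matrix (F : fieldType) (n : nat) (A : 'M[F]_n) : Prop :=
  ~ reducible_matrix A.

Definition row_offdiag_nnz (F : fieldType) (n : nat) (A : 'M[F]_n)
    (i : 'I_n) : nat :=
  #|[pred j : 'I_n | (j != i) && (A i j != 0)]|.

Definition col_bound (R : realType) (n : nat) (A : 'M[R[i]]_n) (i : 'I_n) : R :=
  cmod (A i i) +
  Num.sqrt (\sum_(k < n | k != i) (row_offdiag_nnz A k)%:R * cmod (A k i) ^+ 2).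

Lemma spectral_radius_max (R : realType) (n : nat) (A : 'M[R[i]]_n) :
  (0 < n)%N ->
  (exists2 z, eigenvalue A z & spectral_radius A = cmod z) /\
  (forall z, eigenvalue A z -> cmod z <= spectral_radius A).
Proof.
move=> n_gt0; have [rs] := closed_field_poly_normal (char_poly A).
rewrite (monicP (char_poly_monic A)) scale1r => defp.
have evE z : eigenvalue A z = (z \in rs).
  by rewrite eigenvalue_root_char defp root_prod_XsubC.
have rs_gt0 : (0 < size rs)%N.
  by rewrite -ltnS -(size_prod_XsubC rs id) -defp size_char_poly ltnS.
have maxP (t : seq R[i]) : (0 < size t)%N ->
    exists2 z, z \in t & forall y, y \in t -> cmod y <= cmod z.
  elim: t => // x [|y t] IH _; first by exists x => [|y]; rewrite !inE // => /eqP->.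
  have [z zt zmax] := IH isT.
  have [le_zx|lt_xz] := leP (cmod z) (cmod x).
    exists x; first by rewrite mem_head.
    by move=> w; rewrite inE => /predU1P[->//|/zmax/le_trans]; apply.
  exists z; first by rewrite inE zt orbT.
  by move=> w; rewrite inE => /predU1P[->|/zmax//]; apply: ltW.
have [z zrs zmax] := maxP rs rs_gt0.
have zub : ubound [set cmod z | z in [set z : R[i] | eigenvalue A z]] (cmod z).
  by move=> _ [w /= + <-]; rewrite evE => /zmax.
have ub w : eigenvalue A w -> cmod w <= spectral_radius A.
  by move=> Aw; apply: ub_le_sup; [exists (cmod z) | exists w].
split=> //; exists z; first by rewrite evE.
apply/eqP; rewrite eq_le ub ?evE // andbT.
by apply: ge_sup => //; exists (cmod z), z; rewrite //= evE.
Qed.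

(* Main.v *)
Require Import Defs.
From mathcomp Require Import all_boot all_order all_fingroup all_algebra.
From mathcomp Require Import reals.
From mathcomp Require Import ring.
Import Order.TTheory GRing.Theory Num.Theory.
Local Open Scope ring_scope.

(** Let z be an eigenvalue of maximal modulus, v a row eigenvector for it, and
    write c_i for the square root in the i-th bound, so that the bound is
    |a_ii| + c_i.  Column i of v A = z v reads
      (z - a_ii) v_i = sum over k <> i of v_k a_ki.
    Cauchy-Schwarz with weight l_k on the k-th term gives
      |z - a_ii|^2 |v_i|^2 <= c_i^2 S_i,
    where S_i is the sum of |v_k|^2 / l_k over the k <> i with a_ki <> 0
    (lemma eigen_column_bound).  The weights are chosen so that each k occurs
    in exactly l_k of the S_i; hence the S_i add up to at most the sum of the
    |v_k|^2 (lemma sum_column_mass).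

    Both halves of the theorem follow from one rigidity statement (lemma
    eigenvalue_rigid): if |z| is at least every bound, then |z| equals every
    bound.  Indeed |z - a_ii| >= |z| - |a_ii| >= c_i for all i.  When all c_i
    are positive this yields |v_i|^2 <= S_i for all i, and comparing sums makes
    all of these equalities.  So v_i = 0 forces v_k = 0 as soon as a_ki <> 0:
    the zero set of v is closed in the digraph of A, hence empty by
    irreducibility (lemma irreducible_closed_set) since v <> 0.  Cancelling
    |v_i|^2 = S_i <> 0 leaves |z - a_ii| <= c_i, that is, |z| is at most the
    i-th bound.  If some c_i vanishes then {i} is closed, so n = 1 and
    z = a_ii. *)

(** Listing the elements of Z first puts A in the block form that
    irreducibility excludes, unless Z is everything. *)
Lemma irreducible_closed_set (F : fieldType) (n : nat) (A : 'M[F]_n)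
    (Z : {set 'I_n}) :
  irreducible_matrix A ->
  (forall i k, i \in Z -> k \notin Z -> A k i = 0) ->
  forall i j, i \in Z -> j \in Z.
Proof.
move=> irrA closedZ i j iZ; apply: contraPT irrA => jZ irrA; apply: irrA.
pose e := enum Z ++ enum (~: Z).
have size_e : size e = n by rewrite size_cat -!cardE cardsC card_ord.
have uniq_e : uniq e.
  rewrite cat_uniq !enum_uniq andbT /=; apply/hasPn => x.
  by rewrite !mem_enum inE.
have inj_e : injective (fun k : 'I_n => nth i e k).
  move=> x y /eqP; rewrite nth_uniq ?size_e // => /eqP; exact: val_inj.
have mem_e (k : 'I_n) : (nth i e k \in Z) = (k < #|Z|)%N.
  rewrite nth_cat -cardE; case: ltnP => [ltk|lek].
    by rewrite -mem_enum mem_nth -?cardE.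
  apply/negbTE; rewrite -in_setC -mem_enum mem_nth // -cardE.
  by rewrite ltn_subLR // cardsC card_ord.
exists (perm inj_e), #|Z|; split.
  rewrite card_gt0; apply/andP; split; first by apply/set0Pn; exists i.
  rewrite -[X in (_ < X)%N]card_ord -(cardsC Z) -[X in (X < _)%N]addn0 ltn_add2l.
  by rewrite card_gt0; apply/set0Pn; exists j; rewrite inE.
move=> x y lex lty; rewrite -row_permE tr_perm_mx -col_permE !mxE !permE.
by apply: closedZ; rewrite mem_e // -leqNgt.
Qed.

(** With X the sum of the a_k b_k, Sa that of the w_k a_k^2 and Sb that of the
    b_k^2 / w_k, this is the positivity of the sum of
    w_k (X a_k - Sa b_k / w_k)^2, which equals Sa (Sa Sb - X^2); when Sa = 0,
    all a_k vanish and X = 0. *)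
Lemma weighted_Cauchy_Schwarz (R : realFieldType) (I : finType) (P : pred I)
    (w a b : I -> R) :
  (forall k, P k -> 0 < w k) ->
  (\sum_(k | P k) a k * b k) ^+ 2 <=
  (\sum_(k | P k) w k * a k ^+ 2) * (\sum_(k | P k) b k ^+ 2 / w k).
Proof.
move=> w_gt0; set X := \sum_(k | _) _ * _; set Sa := \sum_(k | _) _ * _.
set Sb := \sum_(k | _) _.
have Sa_term k : P k -> 0 <= w k * a k ^+ 2.
  by move=> Pk; rewrite mulr_ge0 ?sqr_ge0 ?ltW ?w_gt0.
have [Sa_gt0|] := ltP 0 Sa; last first.
  move=> Sa_le0; have Sa0 : Sa = 0 by apply/le_anti; rewrite Sa_le0 sumr_ge0.
  rewrite Sa0 mul0r /X big1 ?expr0n // => k Pk.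
  move/eqP: (psumr_eq0P Sa_term Sa0 Pk).
  by rewrite mulf_eq0 gt_eqF ?w_gt0 //= sqrf_eq0 => /eqP->; rewrite mul0r.
rewrite -subr_ge0 -(pmulr_rge0 _ Sa_gt0).
suff <- : \sum_(k | P k) w k * (X * a k - Sa * (b k / w k)) ^+ 2
          = Sa * (Sa * Sb - X ^+ 2).
  by apply: sumr_ge0 => k Pk; rewrite mulr_ge0 ?sqr_ge0 ?ltW ?w_gt0.
transitivity (\sum_(k | P k) (X ^+ 2 * (w k * a k ^+ 2)
    - (2 * X * Sa) * (a k * b k) + Sa ^+ 2 * (b k ^+ 2 / w k))).
  apply: eq_bigr => k Pk; have wk0 := lt0r_neq0 (w_gt0 k Pk); by field.
rewrite big_split sumrB -!mulr_sumr /= -/X -/Sa -/Sb. ring.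
Qed.

Section ComplexModulus.
Variable R : rcfType.
Implicit Types x y : R[i].

Lemma cmod_ge0 x : 0 <= cmod x.
Proof. by case: x => a b /=; apply: sqrtr_ge0. Qed.

Lemma cmod_eq0 x : (cmod x == 0) = (x == 0).
Proof.
by apply/eqP/eqP => [/Normc.eq0_normc|->] //; apply: Normc.normc0.
Qed.

Lemma cmod_sum_le (I : finType) (P : pred I) (f : I -> R[i]) :
  cmod (\sum_(k | P k) f k) <= \sum_(k | P k) cmod (f k).
Proof.
elim/big_ind2: _ => [|x r y s lex ley|//]; first by rewrite Normc.normc0.
apply: le_trans (lerD lex ley); exact: le_normcD.
Qed.

Lemma cmod_le_sub x y : cmod x <= cmod y + cmod (x - y).
Proof. by rewrite -{1}(subrKC y x) le_normcD. Qed.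

End ComplexModulus.

Section ColumnBounds.
Variables (R : realType) (n : nat) (A : 'M[R[i]]_n).

Local Notation nnz := (row_offdiag_nnz A).

Definition col_support (i : 'I_n) : pred 'I_n :=
  [pred k | (k != i) && (A k i != 0)].

Definition col_energy (i : 'I_n) : R :=
  \sum_(k < n | k != i) (nnz k)%:R * cmod (A k i) ^+ 2.

(** The share of |v_k|^2 that column i receives when row k spreads it evenly
    over its off-diagonal nonzero entries, summed over k. *)
Definition col_mass (v : 'rV[R[i]]_n) (i : 'I_n) : R :=
  \sum_(k < n | col_support i k) cmod (v 0 k) ^+ 2 / (nnz k)%:R.

Lemma row_offdiag_nnz_gt0 i k : col_support i k -> (0 : R) < (nnz k)%:R.
Proof.
move=> /andP[ki Aki]; rewrite ltr0n; apply/card_gt0P; exists i; rewrite inE.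
by rewrite eq_sym ki.
Qed.

Lemma col_energy_ge0 i : 0 <= col_energy i.
Proof. by apply: sumr_ge0 => k _; rewrite mulr_ge0 ?sqr_ge0. Qed.

Lemma col_energy_support i :
  col_energy i = \sum_(k < n | col_support i k) (nnz k)%:R * cmod (A k i) ^+ 2.
Proof.
rewrite /col_energy (bigID (fun k => A k i != 0)) /= [X in _ + X]big1 ?addr0 //.
by move=> k /andP[_ /negbNE/eqP->]; rewrite Normc.normc0 expr0n mulr0.
Qed.

Lemma col_energy_eq0 i k : col_energy i = 0 -> k != i -> A k i = 0.
Proof.
rewrite col_energy_support => E0 ki; apply/eqP/negPn/negP => Aki.
have sk : col_support i k by apply/andP.
move/eqP: (psumr_eq0P (fun j _ => mulr_ge0 (ler0n _ _) (sqr_ge0 _)) E0 sk).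
rewrite mulf_eq0 gt_eqF ?(row_offdiag_nnz_gt0 i) //= sqrf_eq0 cmod_eq0.
by apply/negP.
Qed.

Lemma col_mass_eq0 v i k : col_mass v i = 0 -> col_support i k -> v 0 k = 0.
Proof.
move=> S0 sk.
move/eqP: (psumr_eq0P (fun j _ => divr_ge0 (sqr_ge0 _) (ler0n _ _)) S0 sk).
rewrite mulf_eq0 invr_eq0 [(nnz k)%:R == _]gt_eqF ?(row_offdiag_nnz_gt0 i) //.
by rewrite orbF sqrf_eq0 cmod_eq0 => /eqP.
Qed.

(** Only an inequality, because a row without off-diagonal nonzero entries
    contributes to no column. *)
Lemma sum_column_mass v : \sum_i col_mass v i <= \sum_k cmod (v 0 k) ^+ 2.
Proof.
rewrite (exchange_big_dep xpredT) //=; apply: ler_sum => k _.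
rewrite sumr_const.
have -> : #|[pred i | col_support i k]| = nnz k.
  by apply: eq_card => i; rewrite !inE eq_sym.
have [->|nz] := eqVneq (nnz k) 0%N; first by rewrite mulr0n sqr_ge0.
by rewrite -[leLHS]mulr_natr divfK // pnatr_eq0.
Qed.

(** Cauchy-Schwarz in column i, run over its nonzero off-diagonal entries only:
    there the weight l_k is positive, so that dividing by it is harmless. *)
Lemma eigen_column_bound (z : R[i]) (v : 'rV[R[i]]_n) :
  v *m A = z *: v ->
  forall i, cmod (z - A i i) ^+ 2 * cmod (v 0 i) ^+ 2
            <= col_energy i * col_mass v i.
Proof.
move=> vA i.
have vi : (z - A i i) * v 0 i = \sum_(k < n | col_support i k) A k i * v 0 k.
  move/rowP: vA => /(_ i); rewrite !mxE (bigD1 i) //= mulrBl => <-.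
  rewrite [A i i * _]mulrC addrAC subrr add0r.
  rewrite (bigID (fun k => A k i != 0)) /= [X in _ + X]big1 ?addr0 //.
    by apply: eq_bigr => k _; rewrite mulrC.
  by move=> k /andP[_ /negbNE/eqP->]; rewrite mulr0.
rewrite -exprMn -Normc.normcM vi col_energy_support.
have CS := weighted_Cauchy_Schwarz _ _ (col_support i) (fun k => (nnz k)%:R)
  (fun k => cmod (A k i)) (fun k => cmod (v 0 k)) (row_offdiag_nnz_gt0 i).
apply: le_trans CS.
rewrite ler_pXn2r ?nnegrE ?cmod_ge0 ?sumr_ge0 //; last first.
  by move=> k _; rewrite mulr_ge0 ?cmod_ge0.
apply: le_trans (cmod_sum_le _ _ _ _) _.
by apply: ler_sum => k _; rewrite Normc.normcM.
Qed.

(** Assuming only that |z| is at least the bounds serves both the inequality,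
    by contradiction, and its equality case.  Each estimate between |z - a_ii|
    and c_i is tight as soon as v has no zero entry, and irreducibility rules
    out zero entries. *)
Lemma eigenvalue_rigid (z : R[i]) :
  irreducible_matrix A -> eigenvalue A z ->
  (forall i, col_bound A i <= cmod z) -> forall i, col_bound A i = cmod z.
Proof.
move=> irrA /eigenvalueP[v vA v_neq0] le_z.
have colE := eigen_column_bound z v vA.
have col_boundE i : col_bound A i = cmod (A i i) + Num.sqrt (col_energy i) by [].
have le_sub i : Num.sqrt (col_energy i) <= cmod (z - A i i).
  by rewrite -(lerD2l (cmod (A i i))) (le_trans (le_z i)) ?cmod_le_sub.
have energy_le i : col_energy i <= cmod (z - A i i) ^+ 2.
  by rewrite -(sqr_sqrtr (col_energy_ge0 i)) ler_pXn2r ?nnegrE ?cmod_ge0 ?sqrtr_ge0.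
(* It remains to reverse this estimate in every column. *)
suff sub_le i : cmod (z - A i i) ^+ 2 <= col_energy i.
  move=> i; apply/le_anti; rewrite le_z /= col_boundE.
  apply: le_trans (cmod_le_sub _ z (A i i)) _; rewrite lerD2l.
  by rewrite -(ger0_norm (cmod_ge0 _ (z - A i i))) -sqrtr_sqr ler_wsqrtr.
(* A column vanishing off the diagonal is closed by itself, forcing n = 1. *)
have [i0 /eqP E0|E_neq0] := pickP (fun j => col_energy j == 0).
  have only_i0 j : j = i0.
    apply/set1P; apply: (irreducible_closed_set _ _ A [set i0] irrA _ i0).
      by move=> ? k /set1P->; rewrite inE => /(col_energy_eq0 i0 k E0).
    exact: set11.
  have vi0 : v 0 i0 != 0.
    apply: contra v_neq0 => /eqP vi0; apply/eqP/rowP => j.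
    by rewrite mxE (only_i0 j).
  move: (colE i0); rewrite (only_i0 i) E0 mul0r pmulr_lle0 //.
  by rewrite lt0r sqr_ge0 sqrf_eq0 cmod_eq0 vi0.
have E_gt0 j : 0 < col_energy j by rewrite lt0r E_neq0 col_energy_ge0.
have mass_le j : cmod (v 0 j) ^+ 2 <= col_mass v j.
  rewrite -(ler_pM2l (E_gt0 j)); apply: le_trans (colE j).
  by rewrite ler_wpM2r ?sqr_ge0.
(* The gaps are nonnegative and, by sum_column_mass, their sum is at most 0. *)
have massE j : col_mass v j = cmod (v 0 j) ^+ 2.
  have gap_ge0 k : true -> 0 <= col_mass v k - cmod (v 0 k) ^+ 2.
    by rewrite subr_ge0.
  apply/eqP; rewrite -subr_eq0; apply/eqP/(psumr_eq0P gap_ge0) => //.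
  by apply/le_anti; rewrite sumr_ge0 // sumrB subr_le0 sum_column_mass.
have v_neq0_at j : v 0 j != 0.
  apply: contra v_neq0 => /eqP vj; apply/eqP/rowP => k; rewrite mxE.
  have : k \in [set l | v 0 l == 0]; last by rewrite inE => /eqP.
  apply: (irreducible_closed_set _ _ A _ irrA _ j); last by rewrite inE vj.
  move=> l m; rewrite !inE => /eqP vl vm; apply/eqP/negPn/negP => Aml.
  have sm : col_support l m.
    by apply/andP; split=> //; apply: contraNneq vm => ->; rewrite vl.
  move: vm; rewrite (col_mass_eq0 v l m) ?eqxx //.
  by rewrite massE vl Normc.normc0 expr0n.
move: (colE i); rewrite massE ler_pM2r //.
by rewrite lt0r sqr_ge0 sqrf_eq0 cmod_eq0 v_neq0_at.
Qed.

End ColumnBounds.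

Theorem corollary2p5 (R : realType) (n : nat) (n_gt0 : (0 < n)%N)
    (A : 'M[R[i]]_n) (irrA : irreducible_matrix A) :
  spectral_radius A <= \big[Num.max/0]_(i < n) col_bound A i /\
  (spectral_radius A = \big[Num.max/0]_(i < n) col_bound A i ->
   forall i j : 'I_n, col_bound A i = col_bound A j).
Proof.
have [[z Az ->] _] := spectral_radius_max A n_gt0.
have rigid := eigenvalue_rigid _ _ A z irrA Az; split.
  (* If |z| exceeded every bound it would have to equal one of them. *)
  rewrite leNgt; apply/negP => lt_max.
  have le_z k : col_bound A k <= cmod z.
    exact: le_trans (le_bigmax _ _ k) (ltW lt_max).
  by move: lt_max; rewrite -(rigid le_z (Ordinal n_gt0)) ltNge le_bigmax.
move=> eq_max i j; rewrite !rigid // => k; rewrite eq_max; exact: le_bigmax.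
Qed.
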